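(* Let $r\neq 0$ be a number, let $p(x),q(x),v(x)$ be non-zero polynomials, and let $g(x)=\sum_{n\ge0}g_nx^n$ be a power series which is the expansion of $$g(x)=\frac{q(x)}{v(x)\sqrt[r]{p(x)}}.$$ Define the polynomials $$R=rqpv=\sum_{n=0}^{\deg R}R_nx^n,\qquad Q=rqpv'-rpq'v+qp'v=\sum_{n=0}^{\deg Q}Q_nx^n,$$ and set $R_n=0$ and $Q_n=0$ whenever $n<0$ or $n$ exceeds the respective degree. Then $$\sum_{j=0}^{\deg R}\bigl[(n-j)R_j+Q_{j-1}\bigr]g_{n-j}=0\qquad\text{for all integers } n>\deg R .$$
   Context: Polynomials have complex coefficients and $r$ is a non-zero complex number (not required to be an integer or positive). Primes denote $d/dx$. $\sqrt[r]{p(x)}=p(x)^{1/r}$ denotes an analytic branch, i.e. $\exp(\frac1r L(x))$ where $L$ is analytic with $\exp(L(x))=p(x)$. The statement that the power series $g(x)=\sum_{n\ge0}g_nx^n$ is the expansion of the given expression means: $g$ has a positive radius of convergence, and on some non-empty open connected subset of its disc of convergence $g$ equals the given expression for some choice of analytic branch of the root (the expression being well defined there). *)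

(* Defs.v *)
From HB Require Import structures.
From mathcomp Require Import all_boot all_order all_algebra.
From mathcomp Require Import all_classical all_reals all_analysis.
From mathcomp Require Import complex.

Set Implicit Arguments.
Unset Strict Implicit.
Unset Printing Implicit Defensive.

Import Order.TTheory GRing.Theory Num.Theory.
Import numFieldNormedType.Exports.

Local Open Scope classical_set_scope.
Local Open Scope ring_scope.

(* MathComp-Analysis world.  Packing R[i] as a [numClosedFieldType] gives it
   the topology of a normed module over itself, so that [derivable] below is
   complex differentiability. *)
Definition cplx (R : realType) : numClosedFieldType := R[i].

Section Definitions.
Variable R : realType.
Local Notation C := (cplx R).
Implicit Types (a g : nat -> C) (r x : C) (p q v P : {poly C}) (U : set C).

(* The norm of R[i] takes its (real) values in R[i]. *)
Definition modulus x : R := complex.Re `|x|.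

(* The library's [pseries] is restricted to real series. *)
Definition cpseries a x : nat -> C := series (fun n => a n * x ^+ n).

Definition psum a x : C := limn (cpseries a x).

Definition conv_radius a : \bar R :=
  ereal_sup [set (modulus x)%:E | x in [set x | cvgn (cpseries a x)]].

Definition conv_disc a : set C :=
  [set x | ((modulus x)%:E < conv_radius a)%E].

Definition cexp : C -> C := psum (fun n => (n`!%:R)^-1).

(* [s] is an analytic branch on [U] of the r-th root p(x)^(1/r). *)
Definition root_branch r p U (s : C -> C) : Prop :=
  exists L : C -> C,
    [/\ forall x, U x -> derivable L x 1,
        forall x, U x -> cexp (L x) = p.[x] &
        forall x, U x -> s x = cexp (r^-1 * L x)].

(* A branch of the root never vanishes, so the quotient is well defined on [U]
   exactly when v has no zero there. *)
Definition is_expansion r p q v g : Prop :=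
  (0 < conv_radius g)%E /\
  exists (U : set C) (s : C -> C),
    [/\ open U, connected U, U !=set0 & U `<=` conv_disc g] /\
    [/\ root_branch r p U s,
        forall x, U x -> v.[x] != 0 &
        forall x, U x -> psum g x = q.[x] / (v.[x] * s x)].

(* Only meaningful for P != 0. *)
Definition deg P : nat := (size P).-1.

(* Coefficients at integer indices, zero when the index is negative (or, as
   always for [P`_m], beyond the degree). *)
Definition coefz P (k : int) : C := if k is Posz m then P`_m else 0.

Definition Rpoly r p q v : {poly C} := r *: (q * p * v).

Definition Qpoly r p q v : {poly C} :=
  r *: (q * p * v^`()) - r *: (p * q^`() * v) + q * p^`() * v.

End Definitions.

(* Main.v *)
Require Import Defs.
From mathcomp Require Import all_boot all_order all_algebra.
From mathcomp Require Import all_classical all_reals all_analysis.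
From mathcomp Require Import complex ring lra zify.
Import Order.TTheory GRing.Theory Num.Theory.
Import numFieldNormedType.Exports.
Local Open Scope classical_set_scope.
Local Open Scope ring_scope.

Set Implicit Arguments.
Unset Strict Implicit.
Unset Printing Implicit Defensive.

(** On the open set where g v s = q, with s = exp (L / r) and exp L = p, the
    logarithmic derivative of g shows that R g' + Q g = 0.  The left-hand side
    is a power series on the whole disc of convergence which vanishes on a
    non-empty open subset, hence all its coefficients vanish by the identity
    theorem; the coefficient of index n - 1 is the recurrence, because
    deg Q < deg R < n.
    The complex analysis needed (derivative of a power series, functional
    equation of exp, identity theorem) all comes from re-expanding a power
    series around another point of its disc of convergence. *)

(** * Convergence in R[i] through real moduli *)

Section Modulus.
Variable R : realType.
Local Notation C := (cplx R).
Implicit Types (x y z : C) (a : nat -> C).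

Lemma normE_modulus x : `|x| = ((modulus x)%:C)%C :> C.
Proof. by rewrite /modulus normc_def. Qed.

Lemma modulus_ge0 x : 0 <= modulus x.
Proof. by rewrite -lecR -normE_modulus normr_ge0. Qed.

Lemma modulusM x y : modulus (x * y) = modulus x * modulus y.
Proof. by apply: complexI; rewrite rmorphM /= -!normE_modulus normrM. Qed.

Lemma modulusN x : modulus (- x) = modulus x.
Proof. by rewrite /modulus normrN. Qed.

Lemma modulusBC x y : modulus (x - y) = modulus (y - x).
Proof. by rewrite /modulus distrC. Qed.

Lemma modulus0 : modulus (0 : C) = 0.
Proof. by rewrite /modulus normr0. Qed.

Lemma modulus1 : modulus (1 : C) = 1.
Proof. by rewrite /modulus normr1. Qed.

Lemma modulusD x y : modulus (x + y) <= modulus x + modulus y.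
Proof. by rewrite -lecR rmorphD /= -!normE_modulus ler_normD. Qed.

Lemma modulusX x n : modulus (x ^+ n) = modulus x ^+ n.
Proof.
by elim: n => [|n IH]; rewrite ?expr0 ?modulus1// !exprS modulusM IH.
Qed.

Lemma modulus_eq0 x : (modulus x == 0) = (x == 0).
Proof. by rewrite -(inj_eq (@complexI R)) -normE_modulus normr_eq0. Qed.

Lemma modulusV x : modulus x^-1 = (modulus x)^-1.
Proof.
have [->|x0] := eqVneq x 0; first by rewrite invr0 modulus0 invr0.
have mx0 : modulus x != 0 by rewrite modulus_eq0.
by apply: (mulIf mx0); rewrite -modulusM !mulVf// modulus1.
Qed.

Lemma modulus_gt0 x : (0 < modulus x) = (x != 0).
Proof. by rewrite lt_def modulus_ge0 andbT modulus_eq0. Qed.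

Lemma modulus_real (t : R) : modulus (t%:C)%C = `|t|.
Proof. by rewrite /modulus normc_def /= expr0n addr0 sqrtr_sqr. Qed.

Lemma modulus_nat n : modulus (n%:R : C) = n%:R.
Proof. by rewrite -(rmorph_nat (real_complex R)) modulus_real ger0_norm. Qed.

Lemma modulus_sum (I : Type) (s : seq I) (P : pred I) (F : I -> C) :
  modulus (\sum_(i <- s | P i) F i) <= \sum_(i <- s | P i) modulus (F i).
Proof.
elim/big_rec2: _ => [|i s1 s2 _ le_s]; first by rewrite modulus0.
by rewrite (le_trans (modulusD _ _)) ?lerD2l.
Qed.

Lemma modulus_Re x : `|complex.Re x| <= modulus x.
Proof. by rewrite -lecR -normE_modulus normc_ge_Re. Qed.

Lemma modulus_Im x : `|complex.Im x| <= modulus x.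
Proof.
rewrite /modulus normc_def /= -sqrtr_sqr ler_wsqrtr//.
by rewrite lerDr sqr_ge0.
Qed.

(** In the order of R[i] comparable numbers share their imaginary part, so the radii of balls in [C]
    are real and epsilon arguments can be run in [R]. *)
Lemma pos_realP (e : C) : 0 < e -> exists2 t : R, 0 < t & e = (t%:C)%C.
Proof.
by case: e => t u /andP[/= /eqP -> t0]; exists t.
Qed.

Lemma cvg_modulusP (T : Type) (F : set_system T) {FF : Filter F}
    (f : T -> C) (l : C) :
  f @ F --> l <-> (fun t => modulus (f t - l)) @ F --> (0 : R).
Proof.
split=> [/cvgrPdist_lt fl|/cvgrPdist_lt fl]; apply/cvgrPdist_lt => e e0.
  have := fl (e%:C)%C; rewrite ltcR => /(_ e0); apply: filterS => t.
  by rewrite normE_modulus ltcR sub0r normrN ger0_norm ?modulus_ge0// modulusBC.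
have [t t0 ->] := pos_realP e0.
apply: filterS (fl _ t0) => x.
by rewrite sub0r normrN ger0_norm ?modulus_ge0// normE_modulus ltcR modulusBC.
Qed.

Lemma cvg_modulus (T : Type) (F : set_system T) {FF : Filter F}
    (f : T -> C) (l : C) :
  f @ F --> l -> (fun t => modulus (f t)) @ F --> (modulus l : R).
Proof.
move=> /cvg_modulusP/cvgrPdist_lt fl; apply/cvgrPdist_lt => e /fl.
apply: filterS => t; rewrite sub0r normrN ger0_norm ?modulus_ge0//.
apply: le_lt_trans; rewrite ler_norml.
have := modulusD (f t) (l - f t); have := modulusD l (f t - l).
by rewrite (modulusBC l) !subrKC => *; apply/andP; split; lra.
Qed.

Lemma nbhs_modulusP x (A : set C) :
  nbhs x A <-> exists2 e : R, 0 < e & forall y, modulus (y - x) < e -> A y.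
Proof.
split=> [/nbhs_normP[e /= /pos_realP[t t0 ->] xA]|[e e0 xA]].
  by exists t => // y yx; apply: xA => /=; rewrite normE_modulus ltcR modulusBC.
apply/nbhs_normP; exists (e%:C)%C; first by rewrite /= ltcR.
by move=> y /=; rewrite normE_modulus ltcR modulusBC; exact: xA.
Qed.

Lemma cvg_modulus_le (T : Type) (F : set_system T) {FF : ProperFilter F}
    (f : T -> C) (l : C) (M : R) :
  f @ F --> l -> (\forall t \near F, modulus (f t) <= M) -> modulus l <= M.
Proof.
move=> /cvg_modulusP fl fM; apply/ler_addgt0Pr => e e0.
move/cvgrPdist_lt : fl => /(_ _ e0) fl.
have [t [ft]] := filter_ex (filterI fM fl).
rewrite sub0r normrN ger0_norm ?modulus_ge0// => fe.
rewrite -[l](subrK (f t)) addrC (le_trans (modulusD _ _))// lerD//.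
by rewrite modulusBC ltW.
Qed.

Lemma cvgn_Re_Im (u : nat -> C) :
  cvgn (fun n => complex.Re (u n)) -> cvgn (fun n => complex.Im (u n)) ->
  cvgn u.
Proof.
move=> ua ub; set a := limn _ in ua; set b := limn _ in ub.
suff : u @ \oo --> ((a +i* b)%C : C) by move=> /cvgP.
apply/cvg_modulusP.
apply: (@squeeze_cvgr _ _ _ _ (cst 0)
  (fun n => `|complex.Re (u n) - a| + `|complex.Im (u n) - b|)); last 2 first.
- exact: cvg_cst.
- rewrite -(addr0 0); apply: cvgD; rewrite -(normr0 R); apply: cvg_norm.
  + by rewrite -(subrr a); apply: cvgB => //; exact: cvg_cst.
  + by rewrite -(subrr b); apply: cvgB => //; exact: cvg_cst.
apply: nearW => n; rewrite modulus_ge0/=.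
case: (u n) => p q /=.
have -> : (p +i* q - a +i* b = (p - a)%:C + 'i * (q - b)%:C :> C)%C.
  by simpc.
rewrite (le_trans (modulusD _ _))// modulusM !modulus_real.
suff -> : modulus ('i%C : C) = 1 by rewrite mul1r.
by rewrite /modulus normc_def /= expr0n expr1n add0r sqrtr1.
Qed.

(** Real and imaginary parts are bounded by the modulus, so the real comparison test applies to
    each. *)
Lemma cvgn_series_modulus a :
  cvgn (series (@modulus R \o a)) -> cvgn (series a).
Proof.
move=> ca; apply: cvgn_Re_Im.
- have -> : (fun n => complex.Re (series a n)) = series (@complex.Re R \o a).
    by apply/funext => n; rewrite /series/= raddf_sum.
  apply: normed_cvg; apply: series_le_cvg ca => n //=; first exact: modulus_ge0.
  exact: modulus_Re.
- have -> : (fun n => complex.Im (series a n)) = series (@complex.Im R \o a).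
    by apply/funext => n; rewrite /series/= raddf_sum.
  apply: normed_cvg; apply: series_le_cvg ca => n //=; first exact: modulus_ge0.
  exact: modulus_Im.
Qed.

End Modulus.

(** * Power series *)

Section PowerSeries.
Variable R : realType.
Local Notation C := (cplx R).
Implicit Types (x y z w h : C) (a : nat -> C) (rho d : R).

(** Real majorant of the series on the closed disc of radius [rho]. Its convergence at an explicit
    [rho] stands in for the extended-real radius of convergence in the estimates. *)
Definition abs_series a rho : R ^nat :=
  series (fun n => modulus (a n) * rho ^+ n).

Definition abs_cvg a rho := cvgn (abs_series a rho).

Lemma abs_seriesB a rho m n : (m <= n)%N ->
  abs_series a rho n - abs_series a rho m =
  \sum_(m <= i < n) modulus (a i) * rho ^+ i.
Proof.
by move=> mn; rewrite /abs_series /series/= (big_cat_nat (leq0n m) mn)//=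
   addrAC subrr add0r.
Qed.

Lemma abs_series_nondecreasing a rho : 0 <= rho ->
  nondecreasing_seq (abs_series a rho).
Proof.
move=> rho0 m n mn; rewrite -subr_ge0 abs_seriesB// sumr_ge0// => i _.
by rewrite mulr_ge0 ?modulus_ge0 ?exprn_ge0.
Qed.

Lemma abs_series_le_lim a rho n : 0 <= rho -> abs_cvg a rho ->
  abs_series a rho n <= limn (abs_series a rho).
Proof.
move=> rho0 arho; apply: nondecreasing_cvgn_le => //.
exact: abs_series_nondecreasing.
Qed.

Lemma cpseries_cvg a rho x : abs_cvg a rho -> modulus x <= rho ->
  cvgn (cpseries a x).
Proof.
move=> arho xrho; apply: cvgn_series_modulus; apply: series_le_cvg arho => n /=.
- exact: modulus_ge0.
- by rewrite mulr_ge0 ?modulus_ge0// exprn_ge0// (le_trans _ xrho)//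
    modulus_ge0.
- rewrite modulusM modulusX ler_wpM2l ?modulus_ge0// lerXn2r// nnegrE.
    exact: modulus_ge0.
  exact: le_trans (modulus_ge0 x) xrho.
Qed.

(** Abel's lemma: the terms at [y] tend to 0, hence are bounded by some [M], and the majorant is
    compared with the geometric series of ratio [rho / modulus y]. *)
Lemma cpseries_cvg_abs_cvg a y rho : cvgn (cpseries a y) ->
  0 <= rho < modulus y -> abs_cvg a rho.
Proof.
move=> ay /andP[rho0 rhoy].
have y0 : 0 < modulus y by exact: le_lt_trans rhoy.
have /cvg_modulus ay0 := cvg_series_cvg_0 ay.
have /bounded_fun_has_ubound[M Mub] := cvg_seq_bounded (cvgP _ ay0).
have Mge n : modulus (a n * y ^+ n) <= M by apply: Mub; exists n.
have M0 : 0 <= M by exact: le_trans (modulus_ge0 _) (Mge 0%N).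
have /is_cvg_geometric_series : `|rho / modulus y| < 1.
  by rewrite ger0_norm ?divr_ge0 ?modulus_ge0// ltr_pdivrMr// mul1r.
move=> /(_ M); apply: series_le_cvg => n /=.
- by rewrite mulr_ge0 ?modulus_ge0 ?exprn_ge0.
- by rewrite mulr_ge0 ?exprn_ge0 ?divr_ge0 ?modulus_ge0.
rewrite expr_div_n mulrA ler_pdivlMr ?exprn_gt0// mulrAC ler_wpM2r ?exprn_ge0//.
by have := Mge n; rewrite modulusM modulusX.
Qed.

Lemma conv_disc_abs_cvg a x : conv_disc a x ->
  exists2 rho, modulus x < rho & abs_cvg a rho.
Proof.
move=> /ereal_sup_gt[_ [y ay <-]]; rewrite lte_fin => xy.
exists ((modulus x + modulus y) / 2); first by lra.
apply: cpseries_cvg_abs_cvg ay _; have := modulus_ge0 x.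
by move=> ?; apply/andP; split; lra.
Qed.

(** For i >= m, |x|^i = rho^i (|x|/rho)^i <= rho^i (|x|/rho)^m, which takes a factor (|x|/rho)^m out
    of the tail of the majorant. The orders used are m = 1 for the value at 0, m = 2 for the
    derivative and m = k + 1 for the vanishing of coefficients. *)
Lemma psum_tail a rho x m : 0 < rho -> abs_cvg a rho -> modulus x <= rho ->
  modulus (psum a x - \sum_(0 <= i < m) a i * x ^+ i) <=
  limn (abs_series a rho) * (modulus x / rho) ^+ m.
Proof.
move=> rho0 arho xrho.
set A := limn _; set P := \sum_(_ <= _ < _) _.
have xr01 : 0 <= modulus x / rho <= 1.
  by rewrite divr_ge0 ?modulus_ge0 ?(ltW rho0)//= ler_pdivrMr// mul1r.
apply: (@cvg_modulus_le _ _ \oo _ (fun n => cpseries a x n - P)).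
  by apply: cvgB; [exact: cpseries_cvg arho xrho|exact: cvg_cst].
near=> n; have mn : (m <= n)%N by near: n; exact: nbhs_infty_ge.
have -> : cpseries a x n - P = \sum_(m <= i < n) a i * x ^+ i.
  by rewrite /cpseries /series/= (big_cat_nat (leq0n m) mn)//=
   addrAC subrr add0r.
rewrite (le_trans (modulus_sum _ _ _))//.
have Age : abs_series a rho n - abs_series a rho m <= A.
  rewrite lerBlDr (le_trans (abs_series_le_lim _ (ltW rho0) arho))//.
  rewrite lerDl; apply: sumr_ge0 => i _.
  by rewrite mulr_ge0 ?modulus_ge0 ?exprn_ge0 ?ltW.
apply: le_trans (ler_wpM2r _ Age); last by rewrite exprn_ge0//; case/andP: xr01.
rewrite abs_seriesB// mulr_suml big_nat_cond [leRHS]big_nat_cond ler_sum// => i.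
rewrite andbT => /andP[mi _]; rewrite modulusM modulusX -mulrA.
rewrite ler_wpM2l ?modulus_ge0//.
have -> : modulus x ^+ i = rho ^+ i * (modulus x / rho) ^+ i.
  by rewrite -exprMn mulrC divfK ?gt_eqF.
by rewrite ler_wpM2l ?exprn_ge0 ?(ltW rho0)// ler_wiXn2l//; case/andP: xr01.
Unshelve. all: by end_near. Qed.

Lemma psum_at0 a : (exists2 rho, 0 < rho & abs_cvg a rho) -> psum a 0 = a 0%N.
Proof.
move=> [rho rho0 arho]; have := @psum_tail a rho 0 1 rho0 arho.
rewrite modulus0 mul0r expr1 mulr0 big_nat1 expr0 mulr1 => /(_ (ltW rho0)) h.
apply/eqP; rewrite -subr_eq0 -modulus_eq0 eq_le modulus_ge0 andbT.
exact: h.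
Qed.

End PowerSeries.

(** * Re-expansion around another centre *)

Section Recenter.
Variable R : realType.
Local Notation C := (cplx R).
Implicit Types (x y z w h : C) (a : nat -> C) (rho d : R).

(* The sum of C(n, k) a_n w^(n - k) over n; the binomial kills the terms n < k,
   where the subtraction is truncated. *)
Definition recenter_part a w k : nat -> C :=
  series (fun n => a n * 'C(n, k)%:R * w ^+ (n - k)).

Definition recenter a w k : C := limn (recenter_part a w k).

(** Binomial theorem with the sum cut at [K]: all terms are nonnegative and those with k > n
    vanish. *)
Lemma sum_bin_le (s d : R) n K : 0 <= s -> 0 <= d ->
  \sum_(0 <= k < K) 'C(n, k)%:R * s ^+ (n - k) * d ^+ k <= (s + d) ^+ n.
Proof.
move=> s0 d0.
have F0 k : 0 <= 'C(n, k)%:R * s ^+ (n - k) * d ^+ k.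
  by rewrite !mulr_ge0 ?ler0n ?exprn_ge0.
(* The range n + 1 + K has both the full binomial range and the range [K] as initial segments. *)
have -> : (s + d) ^+ n =
    \sum_(0 <= k < n.+1 + K) 'C(n, k)%:R * s ^+ (n - k) * d ^+ k.
  rewrite (big_cat_nat (leq0n n.+1) (leq_addr _ _))/=.
  rewrite [X in _ = _ + X]big_nat_cond [X in _ = _ + X]big1 ?addr0; last first.
    by move=> i /andP[/andP[ni _] _]; rewrite bin_small// !mul0r.
  rewrite exprDn big_mkord; apply: eq_bigr => i _.
  by rewrite -mulrA mulr_natl.
by rewrite (big_cat_nat (leq0n K) (leq_addl _ _))/= lerDl sumr_ge0.
Qed.

(** Exchanging the two finite sums leaves, for each n, a binomial sum bounded by (|w| + d)^n. *)
Lemma sum_recenter_partB_le a w d K m M : 0 <= d -> (m <= M)%N ->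
  \sum_(0 <= k < K) modulus (recenter_part a w k M - recenter_part a w k m)
    * d ^+ k <=
  abs_series a (modulus w + d) M - abs_series a (modulus w + d) m.
Proof.
move=> d0 mM; rewrite abs_seriesB//.
apply: (@le_trans _ _ (\sum_(0 <= k < K) \sum_(m <= n < M)
   modulus (a n) * ('C(n, k)%:R * modulus w ^+ (n - k) * d ^+ k))).
  apply: ler_sum => k _.
  rewrite /recenter_part /series/= (big_cat_nat (leq0n m) mM)/=.
  rewrite addrAC subrr add0r.
  under [leRHS]eq_bigr do rewrite mulrA.
  rewrite -mulr_suml ler_wpM2r ?exprn_ge0//.
  rewrite (le_trans (modulus_sum _ _ _))// ler_sum// => n _.
  by rewrite !modulusM modulus_nat modulusX mulrA.
rewrite exchange_big/= ler_sum// => n _.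
by rewrite -mulr_sumr ler_wpM2l ?modulus_ge0// sum_bin_le// modulus_ge0.
Qed.

(** Multiplied by d^k, each term of the absolute series is one term of the binomial sum, so the
    partial sums are bounded by the majorant at |w| + d. *)
Lemma recenter_cvg a w d k : 0 < d -> abs_cvg a (modulus w + d) ->
  recenter_part a w k @ \oo --> recenter a w k.
Proof.
move=> d0 arho; apply: cvgn_series_modulus.
apply: nondecreasing_is_cvgn.
  move=> m n mn; rewrite -subr_ge0 /series/= (big_cat_nat (leq0n m) mn)/=.
  by rewrite addrAC subrr add0r sumr_ge0// => i _; exact: modulus_ge0.
exists (limn (abs_series a (modulus w + d)) / d ^+ k) => _ [n _ <-].
have wd0 : 0 <= modulus w + d by rewrite addr_ge0 ?modulus_ge0// ltW.
rewrite ler_pdivlMr ?exprn_gt0//.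
apply: le_trans (abs_series_le_lim n wd0 arho).
rewrite /abs_series /series/= mulr_suml; apply: ler_sum => i _.
rewrite !modulusM modulus_nat modulusX -!mulrA ler_wpM2l ?modulus_ge0//.
(* With cut k + 1 the wanted term is the last one of the binomial sum. *)
apply: le_trans (sum_bin_le i k.+1 (modulus_ge0 w) (ltW d0)).
rewrite big_nat_recr//= mulrA lerDr sumr_ge0// => j _.
by rewrite !mulr_ge0 ?ler0n ?exprn_ge0 ?modulus_ge0// ltW.
Qed.

Lemma cvg_sum_real (f : nat -> R ^nat) (l : R ^nat) K :
  (forall k, f k @ \oo --> l k) ->
  (fun n => \sum_(0 <= k < K) f k n) @ \oo --> \sum_(0 <= k < K) l k.
Proof.
by move=> fl; apply: cvg_big => [|k _]; [exact: add_continuous|exact: fl].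
Qed.

(** Limit M -> oo in [sum_recenter_partB_le], with [K] fixed so that only finitely many limits are
    summed. *)
Lemma sum_recenterB_le a w d K m : 0 < d -> abs_cvg a (modulus w + d) ->
  \sum_(0 <= k < K) modulus (recenter a w k - recenter_part a w k m) * d ^+ k
  <= limn (abs_series a (modulus w + d)) - abs_series a (modulus w + d) m.
Proof.
move=> d0 arho; pose f k n :=
  modulus (recenter_part a w k n - recenter_part a w k m) * d ^+ k.
have fl k : f k @ \oo -->
    modulus (recenter a w k - recenter_part a w k m) * d ^+ k.
  apply: cvgMl; apply: cvg_modulus; apply: cvgB; last exact: cvg_cst.
  exact: recenter_cvg arho.
have sl := cvg_sum_real (K := K) fl.
rewrite -(cvg_lim _ sl)//; apply: limr_le; first exact: cvgP sl.
near=> n; have mn : (m <= n)%N by near: n; exact: nbhs_infty_ge.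
apply: (le_trans (sum_recenter_partB_le _ _ K (ltW d0) mn)).
rewrite lerD2r; apply: abs_series_le_lim => //.
by rewrite addr_ge0 ?modulus_ge0// ltW.
Unshelve. all: by end_near. Qed.

(** Case m = 0 of the previous bound, where the partial sums are empty; the bound does not depend on
    [K]. *)
Lemma abs_cvg_recenter a w d : 0 < d -> abs_cvg a (modulus w + d) ->
  abs_cvg (recenter a w) d.
Proof.
move=> d0 arho; apply: nondecreasing_is_cvgn.
  by apply: abs_series_nondecreasing; exact: ltW.
exists (limn (abs_series a (modulus w + d))) => _ [n _ <-].
have A0 : abs_series a (modulus w + d) 0 = 0.
  by rewrite /abs_series /series/= big_geq.
have := sum_recenterB_le n 0 d0 arho; rewrite A0 subr0.
apply: le_trans; apply: ler_sum => k _.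
by rewrite /recenter_part/series/= big_geq// subr0.
Qed.

(* The partial sum of order K of [a] at w + h is the partial sum of order K of
   [recenter_part a w ^~ K] at h, so the two series differ by at most the tail
   of order K of the dominating series. *)
Lemma psum_recenter a w d h : 0 < d -> abs_cvg a (modulus w + d) ->
  modulus h <= d -> psum a (w + h) = psum (recenter a w) h.
Proof.
move=> d0 arho hd.
have ch := cpseries_cvg (abs_cvg_recenter d0 arho) hd.
have wh : modulus (w + h) <= modulus w + d.
  by rewrite (le_trans (modulusD _ _))// lerD2l.
have cwh := cpseries_cvg arho wh.
suff : (fun K => cpseries (recenter a w) h K - cpseries a (w + h) K) @ \oo -->
    (0 : C).
  move=> dl; apply/esym/eqP; rewrite -subr_eq0; apply/eqP.
  exact: (cvg_unique (@norm_hausdorff _ _) (cvgB ch cwh) dl).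
apply/cvg_modulusP.
have Al : (fun K => limn (abs_series a (modulus w + d))
    - abs_series a (modulus w + d) K) @ \oo --> (0 : R).
  rewrite -[X in _ --> X](subrr (limn (abs_series a (modulus w + d)))).
  by apply: cvgB; [exact: cvg_cst|exact: arho].
apply: (squeeze_cvgr _ (cvg_cst 0) Al).
apply: nearW => K; rewrite modulus_ge0 subr0/=.
apply: le_trans (sum_recenterB_le K K d0 arho).
have -> : cpseries a (w + h) K =
    \sum_(0 <= k < K) recenter_part a w k K * h ^+ k.
  rewrite /cpseries /recenter_part /series/=.
  under [RHS]eq_bigr do rewrite mulr_suml; rewrite exchange_big/=.
  apply: eq_big_nat => n /andP[_ nK].
  rewrite exprDn mulr_sumr (big_cat_nat (leq0n n.+1) nK)/=.
  rewrite [X in _ = _ + X]big_nat_cond [X in _ = _ + X]big1 ?addr0; last first.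
    by move=> i /andP[/andP[ni _] _]; rewrite bin_small// mulr0 !mul0r.
  rewrite big_mkord; apply: eq_bigr => i _.
  by rewrite -mulr_natl !mulrA.
rewrite /cpseries /series/= -sumrB (le_trans (modulus_sum _ _ _))//.
rewrite ler_sum// => k _.
rewrite -mulrBl modulusM modulusX ler_wpM2l ?modulus_ge0//.
by rewrite lerXn2r// nnegrE ?modulus_ge0// ltW.
Qed.

End Recenter.

(** * Derivative, exponential and identity theorem *)

Section Analytic.
Variable R : realType.
Local Notation C := (cplx R).
Implicit Types (x y z w h : C) (a : nat -> C) (rho d : R).

(** Re-expanded at [w], the series differs from its affine part by at most A |h|^2 / d^2, so the
    difference quotient is within A |h| / d^2 of the coefficient of index 1. *)
Lemma is_derive_psum a rho w : abs_cvg a rho -> modulus w < rho ->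
  is_derive w 1 (psum a) (recenter a w 1).
Proof.
move=> arho wrho; have d0 : 0 < rho - modulus w by rewrite subr_gt0.
set d := rho - modulus w in d0.
have rhoE : rho = modulus w + d by rewrite /d addrC subrK.
rewrite {}rhoE in arho.
pose A := limn (abs_series (recenter a w) d).
have psum_w : psum a w = recenter a w 0.
  rewrite -[w in LHS]addr0 (psum_recenter d0 arho) ?modulus0 ?(ltW d0)//.
  by apply: psum_at0; exists d => //; exact: abs_cvg_recenter.
suff dl : (fun h => h^-1 *: (psum a (h *: 1 + w) - psum a w)) @ (0 : C)^' -->
    recenter a w 1.
  by split; [exact: cvgP dl|exact: cvg_lim dl].
apply/cvg_modulusP.
have Bl : (fun h : C => A / d ^+ 2 * modulus h) @ (0 : C)^' --> (0 : R).
  rewrite -[X in _ --> X](mulr0 (A / d ^+ 2)) -(modulus0 R).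
  apply: cvgMr; apply: cvg_modulus; apply: cvg_within_filter; exact: cvg_id.
apply: (squeeze_cvgr _ (cvg_cst 0) Bl).
near=> h; rewrite modulus_ge0/=.
have h0 : h != 0 by near: h; exact: nbhs_dnbhs_neq.
have hd : modulus h <= d.
  near: h; apply: cvg_within; apply/nbhs_modulusP; exists d => // y.
  by rewrite subr0 => /ltW.
have := psum_tail 2 d0 (abs_cvg_recenter d0 arho) hd.
rewrite -(psum_recenter d0 arho hd) big_nat_recr//= big_nat1 expr0 mulr1 expr1.
rewrite -psum_w -/A => tail.
have -> : h^-1 *: (psum a (h *: 1 + w) - psum a w) - recenter a w 1 =
    h^-1 * (psum a (w + h) - (psum a w + recenter a w 1 * h)).
  rewrite [h *: 1]mulr1 [h + w]addrC opprD addrA.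
  by rewrite [RHS]mulrBr [X in _ = _ - X]mulrCA mulVf// mulr1.
rewrite modulusM modulusV mulrC ler_pdivrMr ?modulus_gt0//.
suff <- : A * (modulus h / d) ^+ 2 = A / d ^+ 2 * modulus h * modulus h by [].
by rewrite expr_div_n; ring.
Unshelve. all: by end_near. Qed.

(** For k = 1 the re-expansion coefficient is the formal derivative at [w]; its term n = 0 vanishes,
    whence the shift by one. *)
Lemma cvg_recenter1 a w : cvgn (recenter_part a w 1) ->
  cpseries (fun n => n.+1%:R * a n.+1) w @ \oo --> recenter a w 1.
Proof.
move=> c1; have -> : cpseries (fun n => n.+1%:R * a n.+1) w =
    (fun n => recenter_part a w 1 n.+1).
  apply/funext => n; rewrite /cpseries /recenter_part /series/=.
  rewrite big_nat_recl// bin0n mulr0 mul0r add0r; apply: eq_bigr => i _.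
  by rewrite bin1 subSS subn0 [_%:R * _]mulrC.
by rewrite cvg_shiftS; exact: c1.
Qed.

Lemma psumE a x l : cpseries a x @ \oo --> l -> psum a x = l.
Proof. by move=> axl; exact: (cvg_lim (@norm_hausdorff _ _) axl). Qed.

Lemma psumZ a (c : C) x : cvgn (cpseries a x) ->
  psum (fun n => c * a n) x = c * psum a x.
Proof.
move=> ax; apply: psumE.
have -> : cpseries (fun n => c * a n) x = (fun n => c * cpseries a x n).
  apply/funext => n; rewrite /cpseries/series/= mulr_sumr.
  by apply: eq_bigr => i _; rewrite mulrA.
by apply: cvgMr; exact: ax.
Qed.

Lemma abs_cvg_exp rho : abs_cvg (fun n => (n`!%:R)^-1 : C) rho.
Proof.
rewrite /abs_cvg /abs_series (_ : (fun n => _) = exp_coeff rho).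
  exact: is_cvg_series_exp_coeff.
by apply/funext => n; rewrite /exp_coeff/= modulusV modulus_nat mulrC.
Qed.

Arguments abs_cvg_exp rho : clear implicits.

Lemma cexp_cvg x : cvgn (cpseries (fun n => (n`!%:R)^-1) x).
Proof. exact: (cpseries_cvg (abs_cvg_exp (modulus x)) (lexx _)). Qed.

(** C(n + k, k) / (n + k)! = 1 / (n! k!), and the first k terms vanish. *)
Lemma recenter_exp w k :
  recenter (fun n => (n`!%:R)^-1) w k = cexp w * (k`!%:R)^-1.
Proof.
suff : [sequence recenter_part (fun n => (n`!%:R)^-1) w k (n + k)%N]_n
    @ \oo --> (cexp w * (k`!%:R)^-1 : C).
  by rewrite cvg_shiftn => wk; exact: (cvg_lim (@norm_hausdorff _ _) wk).
have -> : [sequence recenter_part (fun n => (n`!%:R)^-1) w k (n + k)%N]_n =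
    (fun n => cpseries (fun n => (n`!%:R)^-1) w n * (k`!%:R)^-1).
  apply/funext => n; rewrite /cpseries /recenter_part /series/=.
  rewrite (big_cat_nat (leq0n k) (leq_addl n k))/= big_nat_cond.
  rewrite big1; last first.
    by move=> i /andP[/andP[_ ik] _]; rewrite bin_small// mulr0 mul0r.
  rewrite add0r -[X in \sum_(X <= _ < _) _]add0n big_addn addnK mulr_suml.
  apply: eq_bigr => i _; rewrite addnK [RHS]mulrAC; congr (_ * _).
  have f0 m : (m`!)%:R != 0 :> C by rewrite pnatr_eq0 -lt0n fact_gt0.
  apply: (mulfI (f0 (i + k)%N)); rewrite mulVKf//.
  rewrite -(bin_fact (leq_addl i k)) addnK !natrM.
  by rewrite !mulrA mulfK// mulfK.
by apply: cvgMl; exact: cexp_cvg.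
Qed.

(** Re-expansion at [x] multiplies the exponential series by the constant [cexp x]. *)
Lemma cexpD x y : cexp (x + y) = cexp x * cexp y.
Proof.
pose d := modulus y + 1; have d0 : 0 < d by rewrite ltr_wpDl ?modulus_ge0.
rewrite [LHS](psum_recenter d0 (abs_cvg_exp _)); last by rewrite lerDl.
by rewrite (funext (recenter_exp x)) psumZ//; exact: cexp_cvg.
Qed.

Lemma cexp0 : cexp (0 : C) = 1.
Proof.
rewrite [LHS]psum_at0 ?invr1//.
by exists 1 => //; exact: abs_cvg_exp.
Qed.

Lemma cexp_neq0 x : cexp x != 0.
Proof.
apply/eqP => x0; have /eqP := cexp0; rewrite -(subrr x) cexpD x0 mul0r.
by rewrite eq_sym oner_eq0.
Qed.

Lemma is_derive_cexp w : is_derive w 1 (@cexp R) (cexp w).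
Proof.
have w1 : modulus w < modulus w + 1 by rewrite ltrDl.
have := is_derive_psum (abs_cvg_exp _) w1.
by rewrite recenter_exp invr1 mulr1.
Qed.

(** Once the lower coefficients vanish, the tail bound of order k + 1 at a small real point t reads
    |a_k| t^k <= A (t / rho)^(k+1), so |a_k| is at most a constant times t. *)
Lemma coef_eq0 a rho e : 0 < rho -> abs_cvg a rho -> 0 < e ->
  (forall x, modulus x < e -> psum a x = 0) -> forall k, a k = 0.
Proof.
move=> rho0 arho e0 ax; elim/ltn_ind => k IH.
apply/eqP; rewrite -modulus_eq0 eq_le modulus_ge0 andbT.
set A := limn (abs_series a rho).
have A0 : 0 <= A.
  apply: le_trans (abs_series_le_lim 0 (ltW rho0) arho).
  by rewrite /abs_series/series/= big_geq.
(* The added 1 keeps [B] positive when A = 0, so that eps / B makes sense. *)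
pose B := A / rho ^+ k.+1 + 1.
have B0 : 0 < B by rewrite ltr_wpDl// divr_ge0// exprn_ge0// ltW.
apply/ler_addgt0Pr => eps eps0; rewrite add0r.
(* The three bounds give, in order, vanishing of the sum at t, validity of the tail bound, and t B
   <= eps. *)
pose t := Num.min (e / 2) (Num.min rho (eps / B)).
have t0 : 0 < t by rewrite !lt_min rho0 !divr_gt0.
have te : t < e by rewrite gt_min; apply/orP; left; lra.
have trho : t <= rho by rewrite !ge_min lexx orbT.
have tB : t * B <= eps by rewrite -ler_pdivlMr// !ge_min lexx !orbT.
have mt : modulus ((t%:C)%C : C) = t by rewrite modulus_real gtr0_norm.
have := @psum_tail _ a rho (t%:C)%C k.+1 rho0 arho; rewrite mt => /(_ trho).
rewrite ax ?mt// sub0r modulusN big_nat_recr//= big_nat_cond.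
rewrite big1 => [|i]; last first.
  by case/andP=> /andP[_ /IH ->] _; rewrite mul0r.
rewrite add0r modulusM modulusX mt expr_div_n -/A => h.
have : modulus (a k) <= A / rho ^+ k.+1 * t.
  have tk : 0 < t ^+ k by rewrite exprn_gt0.
  rewrite -(ler_pM2r tk) (le_trans h)// le_eqVlt; apply/orP; left; apply/eqP.
  by rewrite [t ^+ k.+1]exprS; ring.
move=> /le_trans; apply; apply: le_trans tB.
by rewrite /B mulrC ler_wpM2l ?(ltW t0)// lerDl.
Qed.

Definition vanishes_near a w :=
  exists2 e : R, 0 < e & forall y, modulus (y - w) < e -> psum a y = 0.

(** All coefficients of the re-expansion at [w] vanish by [coef_eq0], so the sum is zero on the
    whole disc of radius rho - |w| around [w], which contains a disc around [y]. *)
Lemma vanishes_near_step a rho w y : abs_cvg a rho ->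
  modulus (y - w) < rho - modulus w -> vanishes_near a w -> vanishes_near a y.
Proof.
move=> arho yw [e e0 aw]; set d := rho - modulus w in yw.
have d0 : 0 < d by exact: le_lt_trans (modulus_ge0 _) yw.
have rhoE : rho = modulus w + d by rewrite /d addrC subrK.
rewrite {}rhoE in arho.
have c0 k : recenter a w k = 0.
  pose e' := Num.min e d.
  apply: (@coef_eq0 _ d e') => //; first exact: abs_cvg_recenter.
    by rewrite lt_min e0.
  move=> x; rewrite lt_min => /andP[xe /ltW xd].
  by rewrite -(psum_recenter d0 arho xd) aw// addrC addKr.
exists (d - modulus (y - w)); first by rewrite subr_gt0.
move=> z zy; have zd : modulus (z - w) <= d.
  rewrite -(subrK y z) -addrA (le_trans (modulusD _ _))//.
  by rewrite -lerBrDr ltW.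
rewrite -(subrK w z) addrC (psum_recenter d0 arho zd).
apply: psumE; rewrite (_ : cpseries _ _ = cst 0); first exact: cvg_cst.
apply/funext => n; rewrite /cpseries/series/= big1// => i _.
by rewrite c0 mul0r.
Qed.

(* The radius of the re-expansion is at least rho - |w| all along the segment
   from w to 0, so finitely many steps of a fixed length reach 0. *)
Lemma psum_identity a rho w : abs_cvg a rho -> modulus w < rho ->
  vanishes_near a w -> forall k, a k = 0.
Proof.
move=> arho wrho aw; have d0 : 0 < rho - modulus w by rewrite subr_gt0.
have rho0 : 0 < rho by exact: le_lt_trans (modulus_ge0 w) wrho.
suff [e e0 a0] : vanishes_near a 0.
  by apply: (coef_eq0 rho0 arho e0) => x xe; apply: a0; rewrite subr0.
(* Enough steps for the length |w| / m to be below rho - |w|. *)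
pose m := (Num.truncn (modulus w / (rho - modulus w))).+1.
have m0 : 0 < m%:R :> R by rewrite ltr0n.
have wm : modulus w / m%:R < rho - modulus w.
  rewrite ltr_pdivrMr// mulrC -ltr_pdivrMr//.
  exact: truncnS_gt.
have chain i : (i <= m)%N ->
    vanishes_near a (w * ((1 - i%:R / m%:R : R)%:C)%C).
  elim: i => [|i IH] im; first by rewrite mul0r subr0 mulr1.
  apply: (vanishes_near_step arho) (IH (ltnW im)).
  have -> : modulus (w * ((1 - i.+1%:R / m%:R : R)%:C)%C
      - w * ((1 - i%:R / m%:R : R)%:C)%C) = modulus w / m%:R.
    rewrite -mulrBr -rmorphB modulusM modulus_real.
    rewrite (_ : 1 - _ - _ = - m%:R^-1); last by rewrite -natr1; ring.
    by rewrite normrN gtr0_norm ?invr_gt0.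
  rewrite (lt_le_trans wm)// lerD2l lerN2.
  rewrite modulusM ler_piMr ?modulus_ge0// modulus_real ger0_norm.
    by rewrite gerBl divr_ge0.
  by rewrite subr_ge0 ler_pdivrMr// mul1r ler_nat ltnW.
have := chain m (leqnn m).
by rewrite divff ?gt_eqF// subrr rmorph0 mulr0.
Qed.

End Analytic.

(** * The differential equation and its coefficients *)

Section Derivative.
Variable K : numFieldType.
Implicit Types f g : K -> K.

(** In dimension one a differential is multiplication by the derivative, so the chain rule for
    differentials gives the product. *)
Lemma is_derive_comp f g (x a b : K) :
  is_derive (g x) 1 f a -> is_derive x 1 g b -> is_derive x 1 (f \o g) (a * b).
Proof.
move=> [/derivable1_diffP df fE] [/derivable1_diffP dg gE].
have dfg : differentiable (f \o g) x by exact: differentiable_comp.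
split; first exact/derivable1_diffP.
have gE' : 'd g x 1 = b by rewrite -deriveE.
have fE' : 'd f (g x) 1 = a by rewrite -deriveE.
rewrite deriveE// diff_comp//= gE' -[b in LHS]mulr1 [LHS]linearZ fE'.
exact: mulrC.
Qed.

Lemma is_derive_horner (P : {poly K}) (x : K) :
  is_derive x 1 (horner P) P^`().[x].
Proof.
elim/poly_ind: P => [|P c IH].
  rewrite deriv0 horner0 (_ : horner 0 = cst 0); first exact: is_derive_cst.
  by apply/funext => y; rewrite horner0.
rewrite (_ : horner _ = (horner P * id + cst c)); last first.
  by apply/funext => y; rewrite hornerMXaddC.
apply: is_derive_eq.
rewrite derivD derivC addr0 derivM derivX mulr1 !hornerE.
by rewrite /GRing.scale/= mulr1 addrC [x * _]mulrC.
Qed.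

End Derivative.

(** * Product of a polynomial and a power series *)

Section MulSeries.
Variable R : realType.
Local Notation C := (cplx R).
Implicit Types (x : C) (a : nat -> C) (P : {poly C}).

(** Cauchy product coefficient. The guard is needed because truncated subtraction would otherwise
    read [a 0] when j > m. *)
Definition mul_coef P a m : C :=
  \sum_(0 <= j < size P) P`_j * (if (j <= m)%N then a (m - j)%N else 0).

Lemma mul_coef_widen P a m N : (size P <= N)%N ->
  mul_coef P a m =
  \sum_(0 <= j < N) P`_j * (if (j <= m)%N then a (m - j)%N else 0).
Proof.
move=> PN; rewrite (big_cat_nat (leq0n _) PN)/=.
rewrite [X in _ = _ + X]big_nat_cond [X in _ = _ + X]big1 ?addr0// => i.
by case/andP=> /andP[Pi _] _; rewrite nth_default// mul0r.
Qed.

(** Multiplication by X^j turns the partial sum of order N into x^j times the one of order N - j,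
    with the same limit; [P] combines finitely many such shifts. *)
Lemma cvg_mul_coef P a x l : cpseries a x @ \oo --> l ->
  cpseries (mul_coef P a) x @ \oo --> P.[x] * l.
Proof.
move=> al.
have shiftE j N : \sum_(0 <= m < N)
    (if (j <= m)%N then a (m - j)%N else 0) * x ^+ m =
    x ^+ j * cpseries a x (N - j)%N.
  have [jN|Nj] := leqP j N.
    rewrite (big_cat_nat (leq0n j) jN)/= big_nat_cond big1 => [|i]; last first.
      by case/andP=> /andP[_ ij] _; rewrite leqNgt ij mul0r.
    rewrite add0r -[X in \sum_(X <= _ < _) _]add0n big_addn mulr_sumr.
    by apply: eq_bigr => i _; rewrite leq_addl addnK exprD mulrA mulrC.
  (* For N < j both sides are zero. *)
  have /eqP -> : (N - j == 0)%N by rewrite subn_eq0 ltnW.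
  rewrite /cpseries/series/= [in RHS]big_geq// mulr0 big_nat_cond big1// => i.
  by case/andP=> /andP[_ iN] _; rewrite leqNgt (ltn_trans iN Nj) mul0r.
have -> : cpseries (mul_coef P a) x = (fun N =>
    \sum_(0 <= j < size P) P`_j * (x ^+ j * cpseries a x (N - j)%N)).
  apply/funext => N; rewrite /cpseries/series/=.
  under eq_bigr do rewrite mulr_suml; rewrite exchange_big/=.
  apply: eq_bigr => j _; rewrite -shiftE mulr_sumr.
  by apply: eq_bigr => m _; rewrite mulrA.
rewrite horner_coef mulr_suml; under eq_fun do rewrite big_mkord.
apply: cvg_big => [|j _]; first exact: add_continuous.
rewrite -mulrA; apply: cvgMr; apply: cvgMr.
suff : [sequence cpseries a x (N - j)%N]_N @ \oo --> l by [].
by rewrite cvg_centern.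
Qed.

End MulSeries.

(** Here [F] is the value of g, [s] that of exp (L / r), [r'] is 1 / r, and q has been replaced by F
    v s; the other primed letters are derivatives. The hypotheses on [p'] and [q'] are the
    derivatives of exp L = p and F v s = q. *)
Lemma expansion_algebra (K : comPzRingType)
    (r r' F F' L' p v s p' q' v' : K) :
  r * r' = 1 -> p * L' = p' ->
  F * (v * (s * (r' * L')) + s * v') + v * s * F' = q' ->
  r * (F * (v * s) * p * v) * F' + (r * (F * (v * s) * p * v')
    - r * (p * q' * v) + F * (v * s) * p' * v) * F = 0.
Proof.
move=> rr' <- <-.
(* With [p'] and [q'] eliminated, all terms cancel except a multiple of 1 - r r'. *)
transitivity ((1 - r * r') * (p * v * F * F * v * s * L')); first by ring.
by rewrite rr' subrr mul0r.
Qed.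

(** * The differential equation for g and its coefficients *)

Section Expansion.
Variable R : realType.
Local Notation C := (cplx R).
Variables (r : C) (p q v : {poly C}) (g : nat -> C).
Hypothesis r_neq0 : r != 0.

Lemma expansion_ode (U : set C) (s : C -> C) x : open U -> U `<=` conv_disc g ->
  root_branch r p U s -> (forall y, U y -> v.[y] != 0) ->
  (forall y, U y -> psum g y = q.[y] / (v.[y] * s y)) -> U x ->
  (Rpoly r p q v).[x] * recenter g x 1 + (Qpoly r p q v).[x] * psum g x = 0.
Proof.
move=> oU Ug [L [dL Lp sE]] v0 gE Ux.
have nU : \forall y \near x, U y by exact: open_nbhs_nbhs.
have dLx : is_derive x 1 L ('D_1 L x) by apply: derivableP; exact: dL.
have [rho xrho grho] := conv_disc_abs_cvg (Ug _ Ux).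
have dF := is_derive_psum grho xrho.
pose L' : C -> C := fun y => r^-1 * L y.
have dr : is_derive x 1 L' (r^-1 * 'D_1 L x).
  exact: is_deriveZ.
have dS := @is_derive_comp C _ L' _ _ _ (is_derive_cexp (L' x)) dr.
have dvS := is_deriveM (is_derive_horner v x) dS.
have dqE := is_deriveM dF dvS.
(* exp L and p agree near x, hence have the same derivative there. *)
have pE : p.[x] * 'D_1 L x = p^`().[x].
  have dpE := is_derive_comp (is_derive_cexp (L x)) dLx.
  have : \forall y \near x, (@cexp R \o L) y = p.[y].
    by apply: filterS nU => y; exact: Lp.
  move=> /near_eq_is_derive /(_ dpE) [_ pL].
  by have [_ <-] := is_derive_horner p x; rewrite pL Lp.
(* The identity is differentiated in the form g v s = q, free of quotients; the denominator can be
   cleared since exp has no zero. *)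
have qE y : U y -> psum g y * (v.[y] * cexp (r^-1 * L y)) = q.[y].
  move=> Uy; rewrite gE// sE// divfK// mulf_neq0 ?v0//; exact: cexp_neq0.
have : \forall y \near x,
    (psum g * (horner v * (@cexp R \o L'))) y = q.[y].
  by apply: filterS nU => y; exact: qE.
move=> /near_eq_is_derive /(_ dqE) [_ q'E].
have [_ qD] := is_derive_horner q x.
move: q'E; rewrite [X in X = _]qD /GRing.scale/= => /esym q'E.
rewrite /Rpoly /Qpoly !(hornerD, hornerN, hornerZ, hornerM) -(qE _ Ux).
exact: expansion_algebra (mulfV r_neq0) pE q'E.
Qed.

Lemma expansion_coef : is_expansion r p q v g -> forall m,
  mul_coef (Rpoly r p q v) (fun n => n.+1%:R * g n.+1) m
    + mul_coef (Qpoly r p q v) g m = 0.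
Proof.
move=> [_ [U [s [[oU _ [z Uz] Ug] [sr v0 gE]]]]].
have [rho zrho grho] := conv_disc_abs_cvg (Ug _ Uz).
pose b m := mul_coef (Rpoly r p q v) (fun n => n.+1%:R * g n.+1) m
  + mul_coef (Qpoly r p q v) g m.
suff : forall m, b m = 0 by [].
have bx x : modulus x < rho -> cpseries b x @ \oo -->
    ((Rpoly r p q v).[x] * recenter g x 1 + (Qpoly r p q v).[x] * psum g x : C).
  move=> xrho; have d0 : 0 < rho - modulus x by rewrite subr_gt0.
  have grho' : abs_cvg g (modulus x + (rho - modulus x)) by rewrite addrC subrK.
  rewrite (_ : cpseries b x = (fun N =>
    cpseries (mul_coef (Rpoly r p q v) (fun n => n.+1%:R * g n.+1)) x N
    + cpseries (mul_coef (Qpoly r p q v) g) x N)); last first.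
    apply/funext => N; rewrite /cpseries/series/= -big_split/=.
    by apply: eq_bigr => i _; rewrite mulrDl.
  apply: cvgD; apply: cvg_mul_coef.
    have c1 : recenter_part g x 1 @ \oo --> recenter g x 1.
      exact: recenter_cvg d0 grho'.
    by apply: cvg_recenter1; exact: cvgP c1.
  exact: cpseries_cvg grho (ltW xrho).
have z0 := modulus_ge0 z.
(* Two radii strictly between |z| and rho: convergence of the series [b] at the point [rho2] yields
   absolute convergence at [rho1], still beyond |z|. *)
pose rho1 := (modulus z + rho) / 2; pose rho2 := (rho1 + rho) / 2.
have zrho1 : modulus z < rho1 by rewrite /rho1; lra.
have rho12 : rho1 < rho2 by rewrite /rho2 /rho1; lra.
have rho2rho : rho2 < rho by rewrite /rho2 /rho1; lra.
have m2 : modulus ((rho2%:C)%C : C) = rho2.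
  by rewrite modulus_real ger0_norm//; lra.
have brho1 : abs_cvg b rho1.
  apply: (@cpseries_cvg_abs_cvg _ _ (rho2%:C)%C).
    by apply: cvgP; apply: bx; rewrite m2.
  by rewrite m2 rho12 andbT; lra.
apply: (psum_identity brho1 zrho1).
have /nbhs_modulusP[e e0 zU] : nbhs z U by exact: open_nbhs_nbhs.
(* The first bound puts y in U, the second keeps |y| < rho so that [bx] applies. *)
exists (Num.min e (rho - modulus z)).
  by rewrite lt_min e0 subr_gt0.
move=> y; rewrite lt_min => /andP[/zU Uy yz].
rewrite (@psumE _ _ _ _ (bx y _)).
  exact: (expansion_ode oU Ug sr v0 gE Uy).
rewrite -(subrK z y) (le_lt_trans (modulusD _ _))//.
by rewrite -ltrBrDr.
Qed.

End Expansion.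

(** Each product in Q carries the factors of R with one of them differentiated, which costs at least
    one degree. *)
Lemma size_Qpoly_le (R : realType) (r : cplx R) (p q v : {poly cplx R}) :
  r != 0 -> p != 0 -> q != 0 -> v != 0 ->
  (size (Qpoly r p q v) <= deg (Rpoly r p q v))%N.
Proof.
move=> r0 p0 q0 v0; rewrite /deg /Rpoly /Qpoly size_scale//.
have [q1 p1 v1] : [/\ 0 < size q, 0 < size p & 0 < size v]%N.
  by rewrite !size_poly_gt0.
have sd (P : {poly cplx R}) : (size P^`() <= (size P).-1)%N.
  have [->|P0] := eqVneq P 0; first by rewrite deriv0 size_poly0.
  by rewrite -ltnS prednK ?size_poly_gt0// lt_size_deriv.
have s3 (a b c : {poly cplx R}) : (0 < size a)%N ->
    (size (a * b * c)%R <= (size a + size b + size c).-2)%N.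
  move=> a0; apply: (leq_trans (size_polyMleq _ _)).
  by have := size_polyMleq a b; lia.
have E : size (q * p * v) = (size q + size p + size v).-2.
  rewrite !size_mul ?mulf_neq0//.
  by move: (size q) (size p) (size v) q1 p1 v1 => a b c; lia.
rewrite E.
apply: (leq_trans (size_polyD _ _)); rewrite geq_max; apply/andP; split.
  apply: (leq_trans (size_polyD _ _)); rewrite geq_max size_polyN.
  apply/andP; split; apply: (leq_trans (size_scale_leq _ _)).
    by apply: (leq_trans (s3 _ _ _ _)) => //; have := sd v; lia.
  by apply: (leq_trans (s3 _ _ _ _)) => //; have := sd q; lia.
by apply: (leq_trans (s3 _ _ _ _)) => //; have := sd p; lia.
Qed.

Theorem theorem2 (R : realType) (r : cplx R) (p q v : {poly cplx R})
    (g : nat -> cplx R) (r_neq0 : r != 0)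
    (p_neq0 : p != 0) (q_neq0 : q != 0) (v_neq0 : v != 0)
    (g_exp : is_expansion r p q v g) (n : nat)
    (n_gt : (deg (Rpoly r p q v) < n)%N) :
  \sum_(0 <= j < (deg (Rpoly r p q v)).+1)
    ((n - j)%:R * coefz (Rpoly r p q v) j%:Z
       + coefz (Qpoly r p q v) (j%:Z - 1)) * g (n - j)%N = 0.
Proof.
have := expansion_coef r_neq0 g_exp n.-1.
rewrite (@mul_coef_widen _ _ _ _ (deg (Rpoly r p q v)).+1); last first.
  exact: leqSpred.
rewrite (mul_coef_widen _ _ (size_Qpoly_le r_neq0 p_neq0 q_neq0 v_neq0)).
set D := deg _ in n_gt *; move=> b0; rewrite -[RHS]b0.
under eq_bigr do rewrite mulrDl; rewrite big_split/=; congr (_ + _).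
  apply: eq_big_nat => j /andP[_ jD].
  have jn : (j < n)%N by rewrite (leq_ltn_trans _ n_gt).
  (* As j <= deg R < n, the guard holds, and the factor (n - 1 - j) + 1 from the derivative is n -
     j. *)
  rewrite (_ : (j <= n.-1)%N = true); last by lia.
  by rewrite -mulrA mulrCA (_ : (n.-1 - j).+1 = (n - j)%N)//; lia.
(* The term j = 0 carries Q_{-1} = 0; dropping it shifts the index so that Q_j meets g_{n-1-j}. *)
rewrite big_nat_recl//= mul0r add0r; apply: eq_big_nat => j /andP[_ jD].
have jn : (j.+1 < n)%N by rewrite (leq_ltn_trans _ n_gt).
rewrite (_ : (j <= n.-1)%N = true); last by lia.
rewrite subn1/=.
by rewrite (_ : (n.-1 - j)%N = (n - j.+1)%N)//; lia.
Qed.
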